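(* Let $n\in\mathbb{N}$ and let $f\in H_n([0,\infty))$, where $$H_n([0,\infty)) := \big\{f:[0,\infty)\to\mathbb{C} \,\big|\, f^{(j)}\in AC_{loc}([0,\infty)),\ j=0,\dots,n-1;\ f^{(n)}\in L^2((0,\infty));\ f^{(j)}(0)=0,\ j=0,\dots,n-1\big\}.$$ Then: (i) $f^{(n-j)}/x^{j}\in L^2((0,\infty))$ for $j=0,1,\dots,n$; (ii) $\lim_{x\uparrow\infty} |f^{(j)}(x)|^2/x^{2n-2j-1}=0$ for $j=0,1,\dots,n-1$; (iii) $\lim_{x\downarrow 0} |f^{(j)}(x)|^2/x^{2n-2j-1}=0$ for $j=0,1,\dots,n-1$. In addition, for every $n\in\mathbb{N}$, if $f\in \widehat H_n((0,\infty))$ then $f'\in \widehat H_{n-1}((0,\infty))$, where for $m\in\mathbb{N}_0$ $$\widehat H_m((0,\infty)) := \big\{f:(0,\infty)\to\mathbb{C} \,\big|\, f^{(j)}\in AC_{loc}((0,\infty)),\ j=0,\dots,m-1;\ f^{(m)},\ f/x^{m}\in L^2((0,\infty))\big\}$$ (so that $\widehat H_0((0,\infty))=L^2((0,\infty))$).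
   Context: $AC_{loc}([0,\infty))$ denotes functions absolutely continuous on $[0,c]$ for every $c>0$; $AC_{loc}((0,\infty))$ denotes functions absolutely continuous on every compact subinterval of $(0,\infty)$. *)

(* Defs.v *)
From HB Require Import structures.
From mathcomp Require Import all_boot all_order all_algebra.
From mathcomp Require Import all_classical all_reals all_analysis.
From mathcomp Require Import complex.
Set Implicit Arguments. Unset Strict Implicit. Unset Printing Implicit Defensive.
Import Order.TTheory GRing.Theory Num.Theory.
Import numFieldNormedType.Exports.
Local Open Scope classical_set_scope.
Local Open Scope ring_scope.

Section Defs.
Variable R : realType.
Local Notation C := R[i].
Local Notation mu := (@lebesgue_measure R).

Definition Iopen : set R := `]0, +oo[%classic.
Definition Iclosed : set R := `[0, +oo[%classic.

Definition cabs (z : C) : R := Num.sqrt (complex.Re z ^+ 2 + complex.Im z ^+ 2).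

Definition abs_cont_on (a b : R) (f : R -> C) : Prop :=
  forall e : R, 0 < e -> exists2 d : R, 0 < d &
    forall (k : nat) (s t : 'I_k -> R),
      (forall i, a <= s i /\ s i <= t i /\ t i <= b) ->
      (forall i j, i != j -> t i <= s j \/ t j <= s i) ->
      \sum_(i < k) (t i - s i) < d ->
      \sum_(i < k) cabs (f (t i) - f (s i)) < e.

Definition ACloc_c0 (f : R -> C) : Prop :=
  forall c : R, 0 < c -> abs_cont_on 0 c f.

Definition ACloc_o0 (f : R -> C) : Prop :=
  forall a b : R, 0 < a -> a <= b -> abs_cont_on a b f.

Definition cderiv (f : R -> C) (x : R) (l : C) : Prop :=
  is_derive x 1 (fun t => complex.Re (f t)) (complex.Re l) /\
  is_derive x 1 (fun t => complex.Im (f t)) (complex.Im l).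

Definition L2 (g : R -> C) : Prop :=
  measurable_fun Iopen (fun x => complex.Re (g x)) /\
  measurable_fun Iopen (fun x => complex.Im (g x)) /\
  (\int[mu]_(x in Iopen) ((cabs (g x)) ^+ 2)%:E < +oo)%E.

(* g is a family of successive derivatives of f on the domain D up to order m:
   g 0 = f on D, and for j < m, g j is AC_loc (predicate ACloc) and
   g (j+1) is (a.e. on D) the derivative of g j.  Thus g j = f^(j). *)
Definition derivs (D : set R) (ACloc : (R -> C) -> Prop)
    (m : nat) (f : R -> C) (g : nat -> R -> C) : Prop :=
  (forall x, D x -> g 0%N x = f x) /\
  (forall j, (j < m)%N -> ACloc (g j)) /\
  (forall j, (j < m)%N ->
     {ae mu, forall x, D x -> cderiv (g j) x (g j.+1 x)}).

Definition H_c0 (n : nat) (f : R -> C) (g : nat -> R -> C) : Prop :=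
  derivs Iclosed ACloc_c0 n f g /\ L2 (g n) /\
  (forall j, (j < n)%N -> g j 0 = 0).

Definition Hhat (m : nat) (f : R -> C) (g : nat -> R -> C) : Prop :=
  derivs Iopen ACloc_o0 m f g /\ L2 (g m) /\
  L2 (fun x => f x / (x ^+ m)%:C%C).

End Defs.

(* Main.v *)
(* For an absolutely continuous h on [a, b] with h' <= phi almost everywhere,
   h b - h a <= \int_a^b phi: by the fundamental theorem of calculus this
   reduces to the monotonicity of absolutely continuous functions with
   derivative >= 0 a.e., which follows from Cousin's lemma, the exceptional
   null set being covered by an open set of small measure.  Applied to
   2 lam f^(n-1), this gives the Hoelder bound
   |f^(n-1)(b) - f^(n-1)(a)|^2 <= (b - a) \int_a^b |f^(n)|^2, hence (ii) and (iii)
   after integrating down to f^(j).  Applied to v^2 / x^(2k+1), it gives Hardy's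
   inequality |v / x^(k+1)| <= C |v' / x^k| in L^2, hence (i) by induction on k.
   For the last claim, f^(n) in L^2 makes every f^(j), j < n, Hoelder near 0; if
   f^(k) were the first one not tending to 0, |f| would be at least c x^k near 0
   and f / x^n would not be square integrable.  So every f^(j) tends to 0 and
   Hardy's inequality applies as in (i). *)
Require Import Defs.
From HB Require Import structures.
From mathcomp Require Import all_boot all_order all_algebra.
From mathcomp Require Import all_classical all_reals all_analysis.
From mathcomp Require Import measurable_realfun complex.
From mathcomp Require Import ring lra.
Import Order.TTheory GRing.Theory Num.Theory.
Import numFieldNormedType.Exports.
Local Open Scope classical_set_scope.
Local Open Scope ring_scope.
Set Implicit Arguments.
Unset Strict Implicit.

(** * Absolutely continuous functions with nonnegative derivative *)

Definition ac_on (R : realType) (a b : R) (h : R -> R) : Prop :=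
  forall e : R, 0 < e -> exists2 d : R, 0 < d &
    forall (k : nat) (s t : 'I_k -> R),
      (forall i, a <= s i /\ s i <= t i /\ t i <= b) ->
      (forall i j, i != j -> t i <= s j \/ t j <= s i) ->
      \sum_(i < k) (t i - s i) < d ->
      \sum_(i < k) `|h (t i) - h (s i)| < e.

(* Cousin's lemma, in the form of an induction principle along gauge-fine
   partitions of [a, b]. *)
Lemma cousin_ind (R : realType) (a b : R) (P : R -> Prop) : a <= b -> P a ->
  (forall x, a <= x <= b -> exists2 r, 0 < r &
     forall y z, a <= y -> x - r < y -> y <= x -> x <= z -> z < x + r ->
       z <= b -> P y -> P z) ->
  P b.
Proof.
move=> ab Pa step.
pose S := [set x | a <= x <= b /\ P x].
have Sa : S a by rewrite /S/= lexx ab.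
have ubS : has_ubound S by exists b => x [/andP[]].
have ac : a <= sup S by exact: ub_le_sup.
have cb : sup S <= b.
  by apply: ge_sup; [exists a | move=> x [/andP[]]].
have [|r r0 /= stepc] := step (sup S); first by rewrite ac cb.
have [y [/andP[ay yb] Py] cy] : exists2 y, S y & sup S - r < y.
  by apply: sup_adherent => //; split=> //; exists a.
have yc : y <= sup S by apply: ub_le_sup => //; split=> //; rewrite ay yb.
(* The step at the tag [sup S] reaches beyond it unless stopped at [b]. As [z] again lies in [S], it
   cannot exceed [sup S], so the stop occurred and [b] is reached. *)
pose z := Num.min b (sup S + r / 2).
have zb : z <= b by rewrite /z ge_min lexx.
have cz : sup S <= z by rewrite /z le_min cb/= lerDl; lra.
have zr : z < sup S + r by rewrite /z gt_min ltrD2l; apply/orP; right; lra.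
have Pz : P z by exact: (stepc y).
have : z <= sup S.
  by apply: ub_le_sup => //; split => //; rewrite (le_trans ac cz) zb.
rewrite {1}/z ge_min => /orP[bc|]; last by lra.
suff <- : z = b by [].
by apply/eqP; rewrite eq_le zb/= (le_trans bc).
Qed.

Lemma is_derive_linear_approx (R : realType) (h : R -> R) (x l e : R) : 0 < e ->
  is_derive x 1 h l ->
  exists2 r, 0 < r & forall y, `|y - x| < r ->
    `|h y - h x - l * (y - x)| <= e * `|y - x|.
Proof.
move=> e0 [dh dl].
have : (fun t : R => t^-1 *: ((h \o shift x) (t *: 1) - h x)) @ 0^' --> l.
  by rewrite -dl; exact: dh.
move/cvgrPdist_le => /(_ e e0) /nbhs_ballP[r /= r0 hr].
exists r => // y yxr.
have [->|yx] := eqVneq y x; first by rewrite !subrr mulr0 subrr normr0 mulr0.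
have yx0 : y - x != 0 by rewrite subr_eq0.
have := hr (y - x); rewrite /ball/= sub0r normrN => /(_ yxr yx0).
rewrite /= [_ *: 1]mulr1 subrK => le_e.
have -> : h y - h x - l * (y - x) =
    - ((l - (y - x)^-1 * (h y - h x)) * (y - x)) by field.
by rewrite normrN normrM ler_wpM2r.
Qed.

(** Outer regularity of a measurable null set [A] around [N]: the measure of [U] is that of [U]
    minus [A], which is below [d]. *)
Lemma negligible_open_cover (R : realType) (N : set R) (d : R) : 0 < d ->
  (@lebesgue_measure R).-negligible N ->
  exists U, [/\ open U, N `<=` U & (lebesgue_measure U < d%:E)%E].
Proof.
move=> d0 [A [mA A0 NA]].
have [||U [oU AU Ud]] := @lebesgue_regularity_outer R A d mA.
- by rewrite [X in (X < _)%E](_ : _ = 0%E).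
- by [].
exists U; split => //; first exact: subset_trans AU.
have mU : measurable U by exact: open_measurable.
rewrite -(setDUK AU) measureU ?setDIK//; last exact: measurableD.
by rewrite [X in (X + _)%E](_ : _ = 0%E) ?add0e.
Qed.

Lemma negligible_set1 (R : realType) (x : R) :
  (@lebesgue_measure R).-negligible [set x].
Proof. by exists [set x]; split => //; exact: lebesgue_measure_set1. Qed.

(* A finite family of nonoverlapping intervals inside [U], to the left of [x],
   which absorbs the possible decrease of [h] between [a] and [x]. *)
Definition decrease_cover (R : realType) (h : R -> R) (U : set R) (e a x : R)
    : Prop :=
  exists (k : nat) (s t : nat -> R),
    [/\ (forall i, (i < k)%N -> a <= s i /\ s i <= t i /\ t i <= x),
        (forall i j, (i < j < k)%N -> t i <= s j),
        ((\sum_(i < k) (t i - s i))%:E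
           <= lebesgue_measure (U `&` `]a, x]%classic))%E &
        h a <= h x + e * (x - a) + \sum_(i < k) `|h (t i) - h (s i)|].

(** A step with so small a loss is charged to the linear term; the family of intervals stays the
    same. *)
Lemma decrease_cover_small (R : realType) (h : R -> R) (U : set R)
    (e a y z : R) : measurable U -> 0 <= e -> y <= z ->
  h y - e * (z - y) <= h z ->
  decrease_cover h U e a y -> decrease_cover h U e a z.
Proof.
move=> mU e0 yz hyz [k [s [t [st ts sumU ha]]]].
exists k, s, t; split => //.
- by move=> i /st [? [? /le_trans ty]]; do !split => //; exact: ty.
- apply: (le_trans sumU); apply: le_measure; rewrite ?inE.
  + exact: measurableI.
  + exact: measurableI.
  + by apply: setIS; apply: subset_itvl; rewrite bnd_simp.
- apply: (le_trans ha); rewrite lerD2r; lra.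
Qed.

(** A step inside [U] is charged to the family: [[y, z]] becomes its last interval, its length being
    paid for by the growth of the measure of [U] up to [z]. *)
Lemma decrease_cover_in (R : realType) (h : R -> R) (U : set R)
    (e a y z : R) : measurable U -> 0 <= e -> a <= y -> y <= z ->
  `]y, z]%classic `<=` U ->
  decrease_cover h U e a y -> decrease_cover h U e a z.
Proof.
move=> mU e0 ay yz yzU [k [s [t [st ts sumU ha]]]].
exists k.+1, (fun i => if i == k then y else s i),
  (fun i => if i == k then z else t i); split.
- move=> i; rewrite ltnS leq_eqVlt; case: eqP => [_ _|_ /= /st].
    by rewrite ay yz.
  by move=> [? [? /le_trans ty]]; do !split => //; exact: ty.
- move=> i j /andP[ij]; rewrite ltnS leq_eqVlt => jk.
  have ik : (i < k)%N.
    by apply: (leq_trans ij); move: jk => /predU1P[->|/ltnW].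
  rewrite (ltn_eqF ik); move: jk; case: eqP => [_ _|_ /= jk].
    by have [_ []] := st _ ik.
  by apply: ts; rewrite ij.
- rewrite big_ord_recr/= eqxx.
  under eq_bigr do rewrite (ltn_eqF (ltn_ord _)).
  rewrite (_ : _ `&` _ =
    (U `&` `]a, y]%classic) `|` `]y, z]%classic); last first.
    rewrite (@itv_bndbnd_setU _ _ _ (BRight y)) ?bnd_simp// setIUr.
    by congr (_ `|` _); exact: setIidr.
  rewrite measureU//; last 2 first.
  + exact: measurableI.
  + apply/seteqP; split => // x [[_ /=]]; rewrite !in_itv/= => /andP[_ xy].
    by move=> /andP[]; rewrite ltNge xy.
  rewrite EFinD; apply: leeD => //.
  rewrite [leRHS](lebesgue_measure_itv `]y, z]) /= lte_fin -EFinD.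
  by case: ltP => // zy; rewrite lee_fin; lra.
- rewrite big_ord_recr/= eqxx.
  under eq_bigr do rewrite (ltn_eqF (ltn_ord _)).
  have : h y - h z <= `|h z - h y| by rewrite distrC ler_norm.
  have : e * (y - a) <= e * (z - a) by rewrite ler_wpM2l// lerD2r.
  lra.
Qed.

Lemma ac_nondecreasing (R : realType) (a b : R) (h : R -> R) : a <= b ->
  ac_on a b h ->
  {ae (@lebesgue_measure R), forall x, a < x < b ->
     exists2 l, 0 <= l & is_derive x 1 h l} ->
  h a <= h b.
Proof.
move=> ab ach dh.
apply/ler_addgt0Pr => e e0.
(* The total linear loss [e1 * (b - a)] is then at most [e / 2]; adding 1 keeps the denominator
   nonzero when [a = b]. *)
pose e1 := e / (2 * (b - a + 1)).
have ba1 : 0 < b - a + 1 by lra.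
have e10 : 0 < e1 by rewrite divr_gt0// mulr_gt0.
have [d d0 acd] := ach (e / 2) (divr_gt0 e0 (ltr0n _ 2)).
(* The end points go into [U] too, because a derivative is given only inside []a, b[]. *)
have [U [oU NU Ud]] : exists U : set R, [/\ open U,
    ~` [set x | a < x < b -> exists2 l, 0 <= l & is_derive x 1 h l]
      `|` [set a; b] `<=` U & (lebesgue_measure U < d%:E)%E].
  apply: negligible_open_cover => //; apply: negligibleU; first exact: dh.
  by apply: negligibleU; exact: negligible_set1.
have mU : measurable U by exact: open_measurable.
have : decrease_cover h U e1 a b.
  apply: (@cousin_ind _ a b (decrease_cover h U e1 a)) => //.
    exists 0%N, (fun=> 0), (fun=> 0); split.
    - by [].
    - by move=> ? ?; rewrite ltn0 andbF.
    - by rewrite big_ord0; exact: measure_ge0.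
    - by rewrite big_ord0 subrr; lra.
  move=> x /andP[ax xb].
  have [Ux|nUx] := pselect (U x).
    move: oU; rewrite openE => /(_ _ Ux) /nbhs_ballP[r /= r0 xrU].
    exists r => // y z ay xry yx xz zxr zb; apply: decrease_cover_in => //.
    - exact: ltW.
    - exact: le_trans xz.
    - move=> w /=; rewrite in_itv/= => /andP[yw wz]; apply: xrU.
      rewrite /ball/= ltr_norml; apply/andP; split; lra.
  have axb : a < x < b.
    by apply/andP; split; rewrite lt_neqAle ?ax ?xb ?andbT; apply/eqP => xab;
      apply: nUx; apply: NU; right; [left|right].
  have [l l0 /(is_derive_linear_approx e10)[r r0 hr]] :
      exists2 l, 0 <= l & is_derive x 1 h l.
    apply: contra_notP nUx => ndh; apply: NU; by left => /(_ axb)/ndh.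
  exists r => // y z ay xry yx xz zxr zb.
  apply: decrease_cover_small => //; [exact: ltW|exact: le_trans xz|].
  (* Since [l >= 0], linear approximation at the tag gives [h y <= h x + e1 * (x - y)] and
     [h z >= h x - e1 * (z - x)]. *)
  have := hr y; rewrite ler0_norm ?subr_le0// ler_norml => /(_ _)/andP[|_ hy].
    lra.
  have := hr z; rewrite ger0_norm ?subr_ge0// ler_norml => /(_ _)/andP[|hz _].
    lra.
  have : 0 <= l * (z - x) by rewrite mulr_ge0// subr_ge0.
  have : 0 <= l * (x - y) by rewrite mulr_ge0// subr_ge0.
  lra.
move=> [k [s [t [st ts sumU ha]]]].
have sum_lt : \sum_(i < k) `|h (t i) - h (s i)| < e / 2.
  apply: (acd k (fun i => s i) (fun i => t i)).
  - by move=> i; exact: st.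
  - move=> i j; rewrite neq_ltn => /orP[ij|ji]; [left|right]; apply: ts.
      by rewrite ij/=.
    by rewrite ji/=.
  - rewrite -lte_fin; apply: (le_lt_trans sumU); apply: le_lt_trans Ud.
    by apply: le_measure; rewrite ?inE//; exact: measurableI.
have e1E : e1 * (b - a + 1) = e / 2 by rewrite /e1; field; lra.
have : e1 * (b - a) <= e1 * (b - a + 1) by rewrite ler_wpM2l ?(ltW e10)//; lra.
lra.
Qed.

(** * Integrating a bound on the derivative *)

Lemma ac_unif (R : realType) (a b : R) (u : R -> R) (e : R) : ac_on a b u ->
  0 < e -> exists2 d, 0 < d & forall x y, a <= x -> x <= y -> y <= b ->
    y - x < d -> `|u y - u x| < e.
Proof.
move=> acu e0; have [d d0 acd] := acu e e0.
exists d => // x y ax xy yb yxd.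
have := acd 1%N (fun=> x) (fun=> y); rewrite !big_ord1; apply => //.
by move=> i j; rewrite !ord1.
Qed.

(** Along a partition whose mesh forces oscillation below 1, each step raises the bound by 1. *)
Lemma ac_bounded (R : realType) (a b : R) (u : R -> R) : a <= b ->
  ac_on a b u -> exists2 M, 0 <= M & forall x, a <= x <= b -> `|u x| <= M.
Proof.
move=> ab acu; have [d d0 ud] := ac_unif acu ltr01.
apply: (@cousin_ind _ a b (fun y => exists2 M, 0 <= M &
    forall x, a <= x <= y -> `|u x| <= M)) => //.
  by exists `|u a| => // x; rewrite -eq_le => /eqP ->.
move=> x /andP[ax xb]; exists (d / 2); first by rewrite divr_gt0.
move=> y z ay xy yx xz zx zb [M M0 uM]; exists (M + 1); first by lra.
move=> w /andP[aw wz]; have [wy|yw] := leP w y.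
  by rewrite (le_trans (uM w _)) ?aw ?wy// lerDl.
have -> : u w = u y + (u w - u y) by lra.
rewrite (le_trans (ler_normD _ _))// lerD//; first by rewrite uM// ay lexx.
apply/ltW/ud => //; [exact: ltW|exact: le_trans zb|lra].
Qed.

(** The common criterion behind most of the closure properties that follow: sums of increments of
    [h] inherit smallness from those of [u] and [v]. *)
Lemma ac_dominated (R : realType) (a b C : R) (h u v : R -> R) : 0 <= C ->
  ac_on a b u -> ac_on a b v ->
  (forall x y, a <= x <= b -> a <= y <= b ->
    `|h y - h x| <= C * (`|u y - u x| + `|v y - v x|)) ->
  ac_on a b h.
Proof.
move=> C0 acu acv hC e e0.
pose e1 := e / (2 * (C + 1)).
have C1 : 0 < C + 1 by lra.
have e10 : 0 < e1 by rewrite divr_gt0// mulr_gt0.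
have [d1 d10 acd1] := acu e1 e10.
have [d2 d20 acd2] := acv e1 e10.
exists (Num.min d1 d2); first by rewrite lt_min d10.
move=> k s t st dis; rewrite lt_min => /andP[sd1 sd2].
have := acd1 k s t st dis sd1; have := acd2 k s t st dis sd2.
set V := \sum_(i < k) _; set W := \sum_(i < k) _ => Ve We.
apply: (@le_lt_trans _ _ (C * (W + V))).
  rewrite /V /W -big_split/= mulr_sumr; apply: ler_sum => i _.
  have [asi [sti tib]] := st i.
  by apply: hC; [rewrite asi (le_trans sti)|rewrite tib (le_trans asi)].
have -> : e = (C + 1) * (e1 + e1) by rewrite /e1; field; lra.
apply: (@le_lt_trans _ _ (C * (e1 + e1))).
  by rewrite ler_wpM2l// lerD// ltW.
by rewrite ltr_pM2r; lra.
Qed.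

(** * Closure properties of absolutely continuous functions *)

Lemma ac_id (R : realType) (a b : R) : ac_on a b (@id R).
Proof.
move=> e e0; exists e => // k s t st _ /=; apply: le_lt_trans.
by apply: ler_sum => i _; have [_ [? _]] := st i; rewrite ger0_norm ?subr_ge0.
Qed.

Lemma acB (R : realType) (a b : R) (u v : R -> R) :
  ac_on a b u -> ac_on a b v -> ac_on a b (fun x => u x - v x).
Proof.
move=> acu acv; apply: (ac_dominated ler01 acu acv) => x y _ _; rewrite mul1r.
have -> : u y - v y - (u x - v x) = (u y - u x) - (v y - v x) by lra.
exact: ler_normB.
Qed.

Lemma acZ (R : realType) (a b k : R) (u : R -> R) :
  ac_on a b u -> ac_on a b (fun x => k * u x).
Proof.
move=> acu; apply: (@ac_dominated _ a b `|k| _ u u) => // x y _ _.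
by rewrite -mulrBr normrM ler_wpM2l// lerDl.
Qed.

Lemma acM (R : realType) (a b : R) (u v : R -> R) : a <= b ->
  ac_on a b u -> ac_on a b v -> ac_on a b (fun x => u x * v x).
Proof.
move=> ab acu acv.
have [M M0 uM] := ac_bounded ab acu.
have [N N0 vN] := ac_bounded ab acv.
apply: (@ac_dominated _ a b (M + N) _ u v) => //; first exact: addr_ge0.
move=> x y xab yab.
have -> : u y * v y - u x * v x = (u y - u x) * v y + u x * (v y - v x) by ring.
rewrite (le_trans (ler_normD _ _))// !normrM mulrDr lerD//.
  by rewrite mulrC ler_wpM2r// (le_trans (vN _ yab))// lerDr.
by rewrite ler_wpM2r// (le_trans (uM _ xab))// lerDl.
Qed.

Lemma ac_expr (R : realType) (a b : R) (u : R -> R) (n : nat) : a <= b ->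
  ac_on a b u -> ac_on a b (fun x => u x ^+ n).
Proof.
move=> ab acu; elim: n => [|n IHn].
  move=> e e0; exists 1 => // k s t _ _ _.
  by rewrite big1// => i _; rewrite subrr normr0.
rewrite (_ : (fun x => _) = fun x => u x * u x ^+ n); first exact: acM.
by apply/funext => x; rewrite exprS.
Qed.

Lemma ac_inv (R : realType) (a b : R) : 0 < a -> ac_on a b (@GRing.inv R).
Proof.
move=> a0; apply: (@ac_dominated _ a b (a ^- 2) _ id id).
- by rewrite invr_ge0 exprn_ge0// ltW.
- exact: ac_id.
- exact: ac_id.
move=> x y /andP[ax _] /andP[ay _].
have x0 : 0 < x by exact: lt_le_trans ax.
have y0 : 0 < y by exact: lt_le_trans ay.
have -> : y^-1 - x^-1 = (x * y)^-1 * (x - y).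
  by field; rewrite !gt_eqF.
rewrite normrM distrC gtr0_norm ?invr_gt0 ?mulr_gt0//.
apply: ler_pM => //; first by rewrite invr_ge0 mulr_ge0// ltW.
  by rewrite lef_pV2 ?posrE ?exprn_gt0 ?mulr_gt0// expr2 ler_pM// ltW.
by rewrite /= lerDl.
Qed.

(** The increments sum to at most the integral of [|f|] over a union of small measure. Half-open
    intervals are used so that touching ones are disjoint. *)
Lemma ac_integral (R : realType) (a b : R) (f : R -> R) :
  (@lebesgue_measure R).-integrable [set: R] (EFin \o f) ->
  ac_on a b (fun x => \int[@lebesgue_measure R]_(t in `[a, x]) f t).
Proof.
move=> intf e e0.
have [d [d0 intd]] := integral_normr_continuous intf e0.
exists d => // k s t st dis sum_d.
pose F (i : 'I_k) := `]s i, t i]%classic.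
have mF i : measurable (F i) by exact: measurable_itv.
have tF : trivIset [set: 'I_k] F.
  apply/trivIsetP => i j _ _ ij; apply/seteqP; split => // x [/=].
  rewrite /F/= !in_itv/= => /andP[? ?] /andP[? ?].
  by have [] := dis i j ij; lra.
have iF i : (@lebesgue_measure R).-integrable (F i) (EFin \o f).
  by apply: integrableS intf => //; exact: mF.
have muF i : lebesgue_measure (F i) = (t i - s i)%:E.
  have [_ [sti _]] := st i.
  rewrite [LHS](lebesgue_measure_itv `]s i, t i]) /= lte_fin -EFinD.
  by case: ltgtP sti => // ->; rewrite subrr.
apply: (@le_lt_trans _ _ (\sum_(i < k)
    \int[@lebesgue_measure R]_(x in F i) `|f x|)).
  apply: ler_sum => i _; have [asi [sti _]] := st i.
  rewrite (@Rintegral_itvB _ f (BLeft a) (BRight (t i)) (s i)) ?bnd_simp//.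
  - by apply: le_normr_Rintegral => //; exact: iF.
  - exact: integrableS intf.
rewrite sum_fine; last first.
  move=> i _; apply: integrable_fin_num; first exact: mF.
  exact: (integrable_norm (iF i)).
have mf : measurable_fun [set: R] (fun x => `|f x|%:E).
  have /integrableP[/measurable_EFinP mf _] := intf.
  by apply/measurable_EFinP; exact: measurableT_comp.
have /= bigF := @ge0_integral_bigsetU _ _ R (@lebesgue_measure R) 'I_k F
  (fun x => `|f x|%:E) (index_enum _) mF (index_enum_uniq _)
  (sub_trivIset (@subsetT _ _) tF) (measurable_funTS mf)
  (fun x _ => normr_ge0 _).
rewrite [ltLHS](_ : _ = fine (\sum_(i < k) \int[@lebesgue_measure R]_(x in F i) `|f x|%:E)%E) // -bigF.
apply: intd; first by apply: bigsetU_measurable => i _; exact: mF.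
rewrite measure_bigsetU_ord//.
rewrite (eq_bigr (fun i => (t i - s i)%:E)) => [|i _]; last exact: muF.
by rewrite sumEFin lte_fin.
Qed.

Lemma ac_le_integral (R : realType) (a b : R) (h phi : R -> R) : a <= b ->
  ac_on a b h ->
  (@lebesgue_measure R).-integrable `[a, b] (EFin \o phi) ->
  {ae (@lebesgue_measure R), forall x, a < x < b ->
     exists2 l, l <= phi x & is_derive x 1 h l} ->
  h b - h a <= \int[@lebesgue_measure R]_(x in `[a, b]) phi x.
Proof.
move=> ab ach intphi dh.
(* Extension by 0 gives integrability on the whole line, as [ac_integral] and [FTC1] require. *)
pose f := phi \_ `[a, b].
have intf : (@lebesgue_measure R).-integrable [set: R] (EFin \o f).
  by rewrite -restrict_EFin; apply/integrable_restrict => //; rewrite setTI.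
pose F x := \int[@lebesgue_measure R]_(t in `[a, x]) f t.
have Fa : F a = 0 by rewrite /F set_itv1 Rintegral_set1.
have Fb : F b = \int[@lebesgue_measure R]_(x in `[a, b]) phi x.
  by apply: eq_Rintegral => x xab; rewrite /f patchE xab.
have : F a - h a <= F b - h b.
  apply: (@ac_nondecreasing _ a b (fun x => F x - h x)) => //.
    by apply: acB => //; exact: ac_integral.
  have intfy y : (@lebesgue_measure R).-integrable `[a, y] (EFin \o f).
    exact: integrableS intf.
  have locf : locally_integrable [set: R] f.
    exact: integrable_locally_restrict.
  have /= dF := @FTC1 _ f (BLeft a) intfy locf.
  move: dF dh; apply: filterS2; first exact: (ae_filter_ringOfSetsType (@lebesgue_measure R)).
  move=> x dFx dhx axb.
  have [l lphi dhl] := dhx axb.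
  have /andP[ax xb] := axb.
  have [Fx F'x] : derivable F x 1 /\ derive1 F x = f x by apply: dFx; rewrite lte_fin.
  exists (phi x - l); first by rewrite subr_ge0.
  have phiE : f x = phi x by rewrite /f patchE mem_set//= in_itv/= !ltW.
  have dF : is_derive x 1 F (phi x).
    by split => //; rewrite -phiE -F'x derive1E.
  exact: is_deriveB.
rewrite Fa Fb; lra.
Qed.

(** * Functions with square integrable derivative *)

Definition square_integrable (R : realType) (v : R -> R) : Prop :=
  measurable_fun (@Iopen R) v /\
  (\int[@lebesgue_measure R]_(x in @Iopen R) (v x ^+ 2)%:E < +oo)%E.

Definition ac_loc (R : realType) (v : R -> R) : Prop :=
  forall a b : R, 0 < a -> a <= b -> ac_on a b v.

Definition ae_derivative (R : realType) (v v1 : R -> R) : Prop :=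
  {ae (@lebesgue_measure R), forall x, @Iopen R x -> is_derive x 1 v (v1 x)}.

Lemma IopenE (R : realType) (x : R) : @Iopen R x = (0 < x) :> Prop.
Proof. by rewrite /Iopen /= in_itv/= andbT. Qed.

Lemma itv_sub_Iopen (R : realType) (a b : R) : 0 < a ->
  `[a, b]%classic `<=` @Iopen R.
Proof.
move=> a0 x /=; rewrite IopenE in_itv/= => /andP[ax _]; exact: lt_le_trans ax.
Qed.

Lemma measurable_Iopen (R : realType) : measurable (@Iopen R).
Proof. exact: measurable_itv. Qed.

(** Monotonicity of [s * v - L * x]. In the applications [s] is a sign: both signs together give a
    Lipschitz bound, the sign of a function gives its growth in absolute value. *)
Lemma ac_slope_ge (R : realType) (v v1 : R -> R) (a b s L : R) : 0 < a ->
  a <= b -> ac_loc v -> ae_derivative v v1 ->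
  (forall x, a < x < b -> L <= s * v1 x) ->
  L * (b - a) <= s * v b - s * v a.
Proof.
move=> a0 ab acv dv Lv.
have : s * v a - L * a <= s * v b - L * b.
  apply: (@ac_nondecreasing _ a b (fun x => s * v x - L * x)) => //.
    by apply: acB; apply: acZ; [exact: acv|exact: ac_id].
  apply: filterS dv; first exact: (ae_filter_ringOfSetsType (@lebesgue_measure R)).
  move=> x dvx /[dup] axb /andP[ax xb].
  exists (s * v1 x - L); first by rewrite subr_ge0 Lv.
  have {}dvx : is_derive x 1 v (v1 x).
    by apply: dvx; rewrite IopenE (lt_trans a0).
  have -> : s * v1 x - L = s *: v1 x - L *: (1 : R).
    by rewrite /GRing.scale/= mulr1.
  by apply: is_deriveB; apply: is_deriveZ.
lra.
Qed.

Lemma ac_lipschitz (R : realType) (v v1 : R -> R) (a b M : R) : 0 < a ->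
  a <= b -> ac_loc v -> ae_derivative v v1 ->
  (forall x, a < x < b -> `|v1 x| <= M) -> `|v b - v a| <= M * (b - a).
Proof.
move=> a0 ab acv dv Mv.
have lower s : `|s| = 1 -> - M * (b - a) <= s * v b - s * v a.
  move=> s1; apply: (ac_slope_ge a0 ab acv dv) => x /Mv.
  by rewrite -[X in X <= _]mul1r -s1 -normrM ler_norml => /andP[].
have := lower 1 (normr1 _); have := lower (- 1) (normrN1 _).
by rewrite ler_norml => ? ?; apply/andP; split; lra.
Qed.

Lemma square_integrable_integrable (R : realType) (v : R -> R) :
  square_integrable v ->
  (@lebesgue_measure R).-integrable (@Iopen R) (EFin \o (fun x => v x ^+ 2)).
Proof.
move=> [mv iv]; apply/integrableP; split.
  by apply/measurable_EFinP; exact: measurable_funX.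
rewrite (le_lt_trans _ iv)//; under eq_integral => x _.
  rewrite /= ger0_norm ?sqr_ge0//; over.
by [].
Qed.

Lemma square_integrable_itv (R : realType) (v : R -> R) (a b : R) : 0 < a ->
  square_integrable v ->
  (@lebesgue_measure R).-integrable `[a, b] (EFin \o (fun x => v x ^+ 2)).
Proof.
move=> a0 /square_integrable_integrable; apply: integrableS => //.
  exact: measurable_Iopen.
exact: itv_sub_Iopen.
Qed.

Lemma ac_holder (R : realType) (v v1 : R -> R) (a b : R) : 0 < a ->
  a <= b -> ac_loc v -> ae_derivative v v1 -> square_integrable v1 ->
  (v b - v a) ^+ 2 <=
    (b - a) * \int[@lebesgue_measure R]_(x in `[a, b]) (v1 x ^+ 2).
Proof.
move=> a0; rewrite le_eqVlt => /predU1P[->|ab] acv dv L2v.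
  by rewrite !subrr mul0r expr0n.
set I := (X in _ <= _ * X).
(* With slope [lam = (v b - v a) / (b - a)], integrate
   [2 lam v1 <= lam^2 + v1^2]. *)
pose lam := (v b - v a) / (b - a).
have ba0 : 0 < b - a by rewrite subr_gt0.
have lamE : lam * (b - a) = v b - v a by rewrite /lam divfK// gt_eqF.
have int1 : (@lebesgue_measure R).-integrable `[a, b] (EFin \o cst (lam ^+ 2)).
  apply: measurable_bounded_integrable => //.
  - by rewrite /= lebesgue_measure_itv/=; case: ifP => // _; rewrite -EFinD ltry.
  - by exists (`|lam ^+ 2|); split => [|M /ltW lM x _]; [exact: num_real|exact: lM].
have int2 := square_integrable_itv b a0 L2v.
have : 2 * lam * v b - 2 * lam * v a <=
    \int[@lebesgue_measure R]_(x in `[a, b]) (lam ^+ 2 + v1 x ^+ 2).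
  apply: (@ac_le_integral _ a b (fun x => 2 * lam * v x)
    (fun x => lam ^+ 2 + v1 x ^+ 2) (ltW ab)).
  - by apply: acZ; exact: acv (ltW ab).
  - by have H := integrableD _ int1 int2; apply: H; exact: measurable_itv.
  apply: filterS dv; first exact: (ae_filter_ringOfSetsType (@lebesgue_measure R)).
  move=> x dvx /andP[ax xb]; exists (2 * lam * v1 x).
    by have := sqr_ge0 (lam - v1 x); rewrite sqrrB; lra.
  by apply: is_deriveZ; apply: dvx; rewrite IopenE (lt_trans a0).
rewrite RintegralD// -/I Rintegral_cst//.
rewrite [X in _ <= X + _](_ : _ = lam ^+ 2 * (b - a)); last first.
  congr (_ * _); have := @lebesgue_measure_itv R `[a, b].
  by rewrite /= lte_fin ab => /(congr1 fine).
rewrite -mulrBr -lamE (_ : 2 * lam * _ = 2 * (lam ^+ 2 * (b - a))); last by ring.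
move=> H; have : lam ^+ 2 * (b - a) <= I by lra.
move=> /(ler_wpM2l (ltW ba0)); apply: le_trans.
by rewrite (_ : _ ^+ 2 = (b - a) * (lam ^+ 2 * (b - a)))//; ring.
Qed.

(** * Continuity, measurability and comparison of integrals on the open half-line *)

Lemma ac_loc_continuous (R : realType) (v : R -> R) : ac_loc v ->
  forall x, 0 < x -> {for x, continuous v}.
Proof.
move=> acv x x0; apply/cvgrPdist_le => e e0.
have [|d d0 vd] := @ac_unif _ (x / 2) (x * 2) v e _ e0.
  by apply: acv; lra.
near=> y.
have : `|x - y| < Num.min d (x / 2).
  near: y; exists (Num.min d (x / 2)) => //=.
  by rewrite lt_min d0 divr_gt0.
rewrite lt_min !ltr_norml => /andP[/andP[? ?] /andP[? ?]].
have [xy|yx] := leP x y.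
  by rewrite distrC ltW// vd//; lra.
by rewrite ltW// vd//; lra.
Unshelve. all: by end_near. Qed.

Lemma continuous_measurable_Iopen (R : realType) (v : R -> R) :
  (forall x, 0 < x -> {for x, continuous v}) -> measurable_fun (@Iopen R) v.
Proof.
move=> cv; apply: open_continuous_measurable_fun; first exact: interval_open.
by move=> x; rewrite inE IopenE => /cv.
Qed.

Lemma measurable_divX (R : realType) (v : R -> R) (k : nat) :
  measurable_fun (@Iopen R) v ->
  measurable_fun (@Iopen R) (fun x => v x / x ^+ k).
Proof.
move=> mv; apply: measurable_funM => //.
apply: continuous_measurable_Iopen => x x0.
apply: continuous_comp; first exact: exprn_continuous.
by apply: inv_continuous; rewrite gt_eqF// exprn_gt0.
Qed.

Lemma le_Rintegral_Iopen (R : realType) (v : R -> R) (a b : R) : 0 < a ->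
  square_integrable v ->
  \int[@lebesgue_measure R]_(x in `[a, b]) (v x ^+ 2) <=
  \int[@lebesgue_measure R]_(x in @Iopen R) (v x ^+ 2).
Proof.
move=> a0 L2v; have iv := square_integrable_integrable L2v.
have iab := square_integrable_itv b a0 L2v.
rewrite fine_le//.
- by apply: integrable_fin_num iab => //; exact: measurable_itv.
- by apply: integrable_fin_num iv => //; exact: measurable_Iopen.
apply: ge0_subset_integral => //.
- exact: measurable_Iopen.
- by have /integrableP[] := iv.
- by move=> x _; rewrite lee_fin sqr_ge0.
- exact: itv_sub_Iopen.
Qed.

(** * Hardy's inequality *)

(** Monotone convergence along the intervals [[1/(i+1), i+1]], which exhaust the half-line. *)
Lemma square_integrable_bound (R : realType) (v : R -> R) (C : R) :
  measurable_fun (@Iopen R) v ->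
  (forall a b : R, 0 < a -> a <= b ->
    (\int[@lebesgue_measure R]_(x in `[a, b]) (v x ^+ 2)%:E <= C%:E)%E) ->
  square_integrable v.
Proof.
move=> mv vC; split => //; apply: (@le_lt_trans _ _ C%:E); last exact: ltry.
pose F (i : nat) : set R := `[i.+1%:R^-1, i.+1%:R]%classic.
have mF i : measurable (F i) by exact: measurable_itv.
have F0 i : 0 < i.+1%:R^-1 :> R by rewrite invr_gt0.
have mv2 : measurable_fun (@Iopen R) (fun x => (v x ^+ 2)%:E).
  by apply/measurable_EFinP; exact: measurable_funX.
have ndF : nondecreasing_seq F.
  move=> m n mn; rewrite subsetEset => x; rewrite /F/= !in_itv/=.
  move=> /andP[mx xm]; apply/andP; split.
    by apply: le_trans mx; rewrite lef_pV2 ?posrE// ler_nat.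
  by apply: (le_trans xm); rewrite ler_nat.
have -> : @Iopen R = \bigcup_i F i.
  apply/seteqP; split => [x|x [i _]]; last first.
    by rewrite /F/= in_itv/= IopenE => /andP[ix _]; exact: lt_le_trans ix.
  rewrite IopenE => x0.
  have [m xm] : exists m : nat, x < m%:R.
    exists (Num.truncn x).+1; exact: truncnS_gt.
  have [p xp] : exists p : nat, x^-1 < p%:R.
    exists (Num.truncn x^-1).+1; exact: truncnS_gt.
  exists (maxn m p) => //; rewrite /F/= in_itv/=; apply/andP; split.
    rewrite -[leRHS]invrK lef_pV2 ?posrE ?invr_gt0// (le_trans (ltW xp))//.
    by rewrite ler_nat ltnW// ltnS leq_maxr.
  by rewrite (le_trans (ltW xm))// ler_nat ltnW// ltnS leq_maxl.
have cvgF : (\int[@lebesgue_measure R]_(x in F i) (v x ^+ 2)%:E)%E @[i --> \oo] -->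
    (\int[@lebesgue_measure R]_(x in \bigcup_i F i) (v x ^+ 2)%:E)%E.
  apply: ge0_nondecreasing_set_cvg_integral => // [i|i x _].
    apply: measurable_funS mv2; first exact: measurable_Iopen.
    exact: itv_sub_Iopen.
  by rewrite lee_fin sqr_ge0.
rewrite -(cvg_lim _ cvgF)//; apply: lime_le; first by apply/cvg_ex; eexists; exact: cvgF.
near=> i; apply: vC => //.
by rewrite (@le_trans _ _ 1)// ?invf_le1// ler1n.
Unshelve. all: by end_near. Qed.

Lemma ac_loc_div_integrable (R : realType) (v : R -> R) (k : nat) (a b : R) :
  0 < a -> a <= b -> ac_loc v ->
  (@lebesgue_measure R).-integrable `[a, b]
    (EFin \o (fun x => (v x / x ^+ k) ^+ 2)).
Proof.
move=> a0 ab acv.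
have ac2 : ac_on a b (fun x => (v x * x^-1 ^+ k) ^+ 2).
  apply: ac_expr => //; apply: acM => //; first exact: acv.
  by apply: ac_expr => //; exact: ac_inv.
have [M M0 vM] := ac_bounded ab ac2.
apply: measurable_bounded_integrable => //.
- by rewrite /= lebesgue_measure_itv/=; case: ifP => // _; rewrite -EFinD ltry.
- apply: (measurable_funS (@measurable_Iopen R) (itv_sub_Iopen a0)).
  apply: measurable_funX; apply: measurable_divX.
  by apply: continuous_measurable_Iopen; exact: ac_loc_continuous.
- exists M; split => [|N /ltW MN x /=]; first exact: num_real.
  rewrite in_itv/= => xab; apply: le_trans MN; rewrite -exprVn; exact: vM.
Qed.

(** In the variables [p = v' / x^k] and [q = v / x^(k+1)] all powers of [x] cancel, leaving a
    quadratic form in which a square can be completed. *)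
Lemma is_derive_sqr_div (R : realType) (v : R -> R) (x p q : R) (k : nat) :
  0 < x -> v x = q * x ^+ k.+1 -> is_derive x 1 v (p * x ^+ k) ->
  is_derive x 1 (fun y => v y ^+ 2 * (y ^+ (2 * k).+1)^-1)
    (2 * p * q - (2 * k).+1%:R * q ^+ 2).
Proof.
move=> x0 vq dv; have xk0 : x ^+ (2 * k).+1 != 0 by rewrite gt_eqF// exprn_gt0.
have did : is_derive x 1 (@id R) 1 by exact: is_derive_id.
have dX := is_deriveX (2 * k).+1 did.
have xk0' : (@id R ^+ (2 * k).+1) x != 0 by rewrite !fctE.
have dV := @is_deriveV _ (@id R ^+ (2 * k).+1) x _ 1 xk0' dX.
have dv2 := is_deriveX 2 dv.
have := is_deriveM dv2 dV; rewrite /= !fctE => /is_derive_eq; apply.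
rewrite /GRing.scale/= vq mulr1.
have xk : x ^+ k != 0 by rewrite gt_eqF// exprn_gt0.
have x0' : x != 0 by rewrite gt_eqF.
set N := (2 * k).+1%:R.
have -> : x ^+ (2 * k).+1 = x * (x ^+ k * x ^+ k).
  by rewrite (exprS x) mul2n -addnn exprD.
have -> : x ^+ (2 * k) = x ^+ k * x ^+ k by rewrite mul2n -addnn exprD.
rewrite (exprS x k) expr1.
by move: (x ^+ k) xk N => y y0 N; field; rewrite ?y0 ?x0'.
Qed.

(* Pointwise, [(v^2 / x^(2k+1))' <= 2 (v' / x^k)^2 - (v / x^(k+1))^2 / 2] by
   completing the square; integrating gives Hardy's inequality, since
   [v^2 / x^(2k+1)] is bounded. *)
Lemma hardy (R : realType) (v v1 : R -> R) (k : nat) (I : R) :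
  ac_loc v -> ae_derivative v v1 ->
  (forall x, 0 < x -> v x ^+ 2 <= I * x ^+ (2 * k).+1) ->
  square_integrable (fun x => v1 x / x ^+ k) ->
  square_integrable (fun x => v x / x ^+ k.+1).
Proof.
move=> acv dv vI L2v1.
pose W := \int[@lebesgue_measure R]_(x in @Iopen R) ((v1 x / x ^+ k) ^+ 2).
(* The boundary term at [b] is nonnegative and that at [a] is at most [I], so half of the wanted
   integral is at most [I + 2 * W]. *)
apply: (@square_integrable_bound _ _ (2 * (I + 2 * W))).
  apply: measurable_divX; apply: continuous_measurable_Iopen.
  exact: ac_loc_continuous.
move=> a b a0 ab.
have b0 : 0 < b by exact: lt_le_trans ab.
have int1 := square_integrable_itv b a0 L2v1.
have int2 := ac_loc_div_integrable k.+1 a0 ab acv.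
have intZ1 := integrableZl _ 2 int1.
have intZ2 := integrableZl _ (2^-1) int2.
have int3 := integrableB _ (intZ1 _) (intZ2 _).
have : v b ^+ 2 * (b ^+ (2 * k).+1)^-1 - v a ^+ 2 * (a ^+ (2 * k).+1)^-1 <=
    \int[@lebesgue_measure R]_(x in `[a, b])
      (2 * (v1 x / x ^+ k) ^+ 2 - 2^-1 * (v x / x ^+ k.+1) ^+ 2).
  apply: (@ac_le_integral _ a b
    (fun y => v y ^+ 2 * (y ^+ (2 * k).+1)^-1)) => //.
  - apply: acM => //; first by apply: ac_expr => //; exact: acv.
    rewrite (_ : (fun _ => _) = (fun x : R => x^-1 ^+ (2 * k).+1)); last first.
      by apply/funext => x; rewrite exprVn.
    by apply: ac_expr => //; exact: ac_inv.
  - by apply: int3; exact: measurable_itv.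
  apply: filterS dv; first exact: (ae_filter_ringOfSetsType (@lebesgue_measure R)).
  move=> x dvx /andP[ax xb]; have x0 : 0 < x by exact: lt_trans ax.
  have xk0 : x ^+ k != 0 by rewrite gt_eqF// exprn_gt0.
  have xk10 : x ^+ k.+1 != 0 by rewrite gt_eqF// exprn_gt0.
  set p := v1 x / x ^+ k; set q := v x / x ^+ k.+1.
  exists (2 * p * q - (2 * k).+1%:R * q ^+ 2); last first.
    apply: is_derive_sqr_div => //; first by rewrite /q divfK.
    by rewrite /p divfK//; apply: dvx; rewrite IopenE.
  have : 1 * q ^+ 2 <= (2 * k).+1%:R * q ^+ 2.
    by rewrite ler_wpM2r ?sqr_ge0// ler1n.
  have := sqr_ge0 (p - q / 2); rewrite sqrrB.
  rewrite expr_div_n; nra.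
rewrite RintegralB//; last 2 first.
- by apply: intZ1; exact: measurable_itv.
- by apply: intZ2; exact: measurable_itv.
rewrite !RintegralZl//.
have := le_Rintegral_Iopen b a0 L2v1; rewrite -/W.
have : 0 <= v b ^+ 2 * (b ^+ (2 * k).+1)^-1.
  by rewrite mulr_ge0 ?sqr_ge0// invr_ge0 exprn_ge0// ltW.
have : v a ^+ 2 * (a ^+ (2 * k).+1)^-1 <= I.
  by rewrite ler_pdivrMr ?exprn_gt0//; exact: vI.
set J := (X in _ <= _ - _ * X) => Ia hb JW H.
have JE : (\int[@lebesgue_measure R]_(x in `[a, b]) ((v x / x ^+ k.+1) ^+ 2)%:E)%E
    = J%:E.
  by rewrite fineK//; apply: integrable_fin_num int2 => //; exact: measurable_itv.
rewrite JE lee_fin.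
lra.
Qed.

(** * Chains of successive derivatives vanishing at 0 *)

(** Regularity is asked only away from 0, so that one notion serves both function spaces; the
    behaviour at 0 enters through [vanishes_at0]. *)
Definition derivative_chain (R : realType) (n : nat) (u : nat -> R -> R) : Prop :=
  (forall j, (j < n)%N -> ac_loc (u j)) /\
  (forall j, (j < n)%N -> ae_derivative (u j) (u j.+1)).

Definition vanishes_at0 (R : realType) (v : R -> R) : Prop :=
  forall e, 0 < e -> exists2 d, 0 < d & forall x, 0 < x < d -> `|v x| < e.

(** Letting [a] tend to 0 in a bound on increments; this replaces evaluation at 0, a point outside
    the open half-line. *)
Lemma vanishing_le (R : realType) (v : R -> R) (x M : R) : 0 < x ->
  vanishes_at0 v -> (forall a, 0 < a < x -> `|v x - v a| <= M) -> `|v x| <= M.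
Proof.
move=> x0 v0 vM; apply/ler_addgt0Pr => e e0.
have [d d0 vd] := v0 e e0.
pose a := Num.min (d / 2) (x / 2).
have a0 : 0 < a by rewrite lt_min !divr_gt0.
have ad : a < d by rewrite gt_min; apply/orP; left; lra.
have ax : a < x by rewrite gt_min; apply/orP; right; lra.
rewrite -(subrK (v a) (v x)) (le_trans (ler_normD _ _))// lerD//.
  by apply: vM; rewrite a0.
by apply/ltW/vd; rewrite a0.
Qed.

(** Hölder from 0 bounds [u n] on []0, x]] by [M] with [M^2 = x * K], and each lower order gains a
    factor [x]. Taking [K] as the full integral gives boundedness, a small [K] gives the limit at
    0. *)
Lemma chain_bound (R : realType) (n m : nat) (u : nat -> R -> R) (x K : R) :
  derivative_chain n.+1 u -> square_integrable (u n.+1) ->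
  (forall j, (j <= n)%N -> vanishes_at0 (u j)) ->
  0 < x ->
  (forall a b, 0 < a -> a <= b -> b <= x ->
     \int[@lebesgue_measure R]_(t in `[a, b]) (u n.+1 t ^+ 2) <= K) ->
  (m <= n)%N -> u (n - m)%N x ^+ 2 <= K * x ^+ (2 * m).+1.
Proof.
move=> [acu du] L2u u0 x0 intK mn.
have K0 : 0 <= K.
  by have := intK x x x0 (lexx _) (lexx _); rewrite set_itv1 Rintegral_set1.
pose M := Num.sqrt (x * K).
have M0 : 0 <= M by exact: sqrtr_ge0.
have M2 : M ^+ 2 = x * K by rewrite sqr_sqrtr// mulr_ge0// ltW.
(* The bound is uniform in [y], so that at one level it is a Lipschitz constant for the next. *)
suff H : forall y, 0 < y <= x -> `|u (n - m)%N y| <= M * x ^+ m.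
  have := H x; rewrite x0 lexx => /(_ isT) ux.
  rewrite -[leLHS]real_normK ?num_real//.
  apply: (@le_trans _ _ ((M * x ^+ m) ^+ 2)).
    by rewrite lerXn2r ?nnegrE// mulr_ge0// exprn_ge0// ltW.
  rewrite exprMn M2 (exprS x) mul2n -addnn exprD.
  by rewrite (_ : _ * _ ^+ 2 = K * (x * (x ^+ m * x ^+ m)))//; ring.
elim: m mn => [|m IHm] mn y /andP[y0 yx].
  rewrite subn0 expr0 mulr1; apply: vanishing_le => //; first exact: u0.
  move=> a /andP[a0 ay].
  have := ac_holder a0 (ltW ay) (acu n (ltnSn n)) (du n (ltnSn n)) L2u.
  move=> H; rewrite -ler_sqr ?nnegrE// real_normK ?num_real// M2.
  apply: (le_trans H); apply: ler_pM => //; [lra| |lra|].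
    by apply: Rintegral_ge0 => z _; exact: sqr_ge0.
  by apply: intK => //; exact: ltW.
have nm : (n - m.+1 <= n)%N by exact: leq_subr.
apply: vanishing_le => //; first exact: u0.
move=> a /andP[a0 ay].
have dv := du (n - m.+1)%N nm; rewrite subnSK// in dv.
have := ac_lipschitz a0 (ltW ay) (acu (n - m.+1)%N nm) dv.
move=> /(_ (M * x ^+ m))/(_ _) H.
apply: (@le_trans _ _ (M * x ^+ m * (y - a))).
  apply: H => z /andP[az zy]; apply: IHm; first exact: ltnW.
  by rewrite (lt_trans a0 az)/= ltW// (lt_le_trans zy).
rewrite exprSr mulrA ler_wpM2l ?mulr_ge0 ?exprn_ge0 ?(ltW x0)//; lra.
Qed.

(** Induction on [k]: each use of [hardy] lowers the order of the derivative by one and adds one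
    power of [x]; its pointwise hypothesis is [chain_bound] with the full integral. *)
Lemma chain_hardy (R : realType) (n k : nat) (u : nat -> R -> R) :
  derivative_chain n.+1 u -> square_integrable (u n.+1) ->
  (forall j, (j <= n)%N -> vanishes_at0 (u j)) ->
  (k <= n.+1)%N ->
  square_integrable (fun x => u (n.+1 - k)%N x / x ^+ k).
Proof.
move=> cu L2u u0; elim: k => [|k IHk] kn.
  rewrite subn0 (_ : (fun x => _) = u n.+1)//.
  by apply/funext => x; rewrite expr0 divr1.
have [acu du] := cu.
have dv : ae_derivative (u (n.+1 - k.+1)%N) (u (n.+1 - k)%N).
  by have := du (n - k)%N; rewrite ltnS leq_subr subSS subSn// => /(_ isT).
apply: hardy dv _ (IHk (ltnW kn)).
  by apply: acu; rewrite subSS ltnS leq_subr.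
move=> x x0; rewrite subSS; apply: (chain_bound cu L2u u0 x0) => // a b a0 ab _.
exact: (le_Rintegral_Iopen b a0 L2u).
Qed.

(** * Smallness of the integral near 0 and near infinity, and growth at infinity *)

Lemma integral_small_at0 (R : realType) (v : R -> R) (e : R) : 0 < e ->
  square_integrable v -> exists2 d, 0 < d & forall a b, 0 < a -> a <= b -> b < d ->
    \int[@lebesgue_measure R]_(t in `[a, b]) (v t ^+ 2) <= e.
Proof.
move=> e0 L2v; pose f := (fun x => v x ^+ 2) \_ (@Iopen R).
have intf : (@lebesgue_measure R).-integrable [set: R] (EFin \o f).
  rewrite -restrict_EFin; apply/integrable_restrict => //.
    exact: measurable_Iopen.
  by rewrite setTI; exact: square_integrable_integrable.
have [d [d0 intd]] := integral_normr_continuous intf e0.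
exists d => // a b a0 ab bd; apply: ltW.
have -> : \int[@lebesgue_measure R]_(t in `[a, b]) (v t ^+ 2) =
    \int[@lebesgue_measure R]_(t in `[a, b]) `|f t|.
  apply: eq_Rintegral => x; rewrite inE => /(itv_sub_Iopen a0) x0.
  by rewrite /f patchE mem_set// ger0_norm// sqr_ge0.
apply: intd; first exact: measurable_itv.
rewrite [X in (X < _)%E](lebesgue_measure_itv `[a, b])/= lte_fin.
by case: ifP => _; rewrite -?EFinD lte_fin//; lra.
Qed.

(** Once [[a, b]] comes within [e] of the supremum of the integrals over compact intervals, at most
    [e] is left beyond [b]. *)
Lemma integral_small_aty (R : realType) (v : R -> R) (e : R) : 0 < e ->
  square_integrable v -> exists2 A, 0 < A & forall a b, A <= a -> a <= b ->
    \int[@lebesgue_measure R]_(t in `[a, b]) (v t ^+ 2) <= e.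
Proof.
move=> e0 L2v.
pose S := [set y | exists a b : R, [/\ 0 < a, a <= b &
  y = \int[@lebesgue_measure R]_(t in `[a, b]) (v t ^+ 2)]].
have supS : has_sup S.
  split; first by eexists; exists 1, 1; split.
  exists (\int[@lebesgue_measure R]_(t in @Iopen R) (v t ^+ 2)).
  by move=> _ [a [b [a0 ab ->]]]; exact: le_Rintegral_Iopen.
have [_ [a [b [a0 ab ->]]] Sab] := sup_adherent e0 supS.
exists (b + 1) => [|c d bc cd]; first by rewrite addr_gt0// (lt_le_trans a0).
have cdE : \int[@lebesgue_measure R]_(t in `[c, d]) (v t ^+ 2) <=
    \int[@lebesgue_measure R]_(t in `]b, d]) (v t ^+ 2).
  have iad := square_integrable_itv d a0 L2v.
  rewrite fine_le//.
  - apply: integrable_fin_num; first exact: measurable_itv.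
    by apply: integrableS iad => //; apply: subset_itvr; rewrite bnd_simp; lra.
  - apply: integrable_fin_num; first exact: measurable_itv.
    by apply: integrableS iad => //; apply: subset_itvr; rewrite bnd_simp; lra.
  apply: ge0_subset_integral => //.
  - apply: measurable_funS (measurable_int _ iad) => //.
    by apply: subset_itvr; rewrite bnd_simp; lra.
  - by move=> x _; rewrite lee_fin sqr_ge0.
  - by apply: subset_itvr; rewrite bnd_simp; lra.
apply: (le_trans cdE).
rewrite -(@Rintegral_itvB _ _ (BLeft a)) ?bnd_simp//; last 2 first.
- exact: square_integrable_itv.
- lra.
have : \int[@lebesgue_measure R]_(t in `[a, d]) (v t ^+ 2) <= sup S.
  apply: ub_le_sup; first by case: supS.
  by exists a, d; split => //; lra.
move: Sab; lra.
Qed.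

(* Only increments matter, the starting value being negligible. *)
Lemma increment_aty (R : realType) (v : R -> R) (p : nat) (e : R) : 0 < e ->
  (exists2 A, 0 < A & forall x, A <= x ->
     (v x - v A) ^+ 2 <= e / 4 * x ^+ p.+1) ->
  exists2 A, 0 < A & forall x, A <= x -> v x ^+ 2 <= e * x ^+ p.+1.
Proof.
move=> e0 [A A0 HA].
(* [B >= 1] ensures [x <= x ^+ p.+1], and the quotient ensures [4 * v A ^+ 2 <= e * x]. *)
pose B := Num.max (Num.max A 1) (4 * v A ^+ 2 / e).
have AB : A <= B by rewrite /B !le_max lexx.
exists B => [|x Bx]; first exact: lt_le_trans AB.
have Ax : A <= x by exact: le_trans Bx.
have x1 : 1 <= x by rewrite (le_trans _ Bx)// /B !le_max lexx orbT.
have : 4 * v A ^+ 2 <= e * x.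
  by rewrite [leRHS]mulrC -ler_pdivrMr// (le_trans _ Bx)// /B le_max lexx orbT.
have : e * x <= e * x ^+ p.+1.
  rewrite ler_wpM2l ?(ltW e0)// exprS ler_peMr ?exprn_ege1//; lra.
have := HA x Ax.
set w := v x; set z := v A; set X := x ^+ _ => H1 H2 H3.
(* This square encodes [w^2 <= 2 (w - z)^2 + 2 z^2], where each term is at most half of [e * X]. *)
have := sqr_ge0 (w - 2 * z); nra.
Qed.

(** A small tail integral controls the increments of [u n] by Hölder; a bound on one derivative over
    [[A, x]] then controls the next lower one with an extra factor [x]. [increment_aty] absorbs the
    value at [A]. *)
Lemma chain_aty (R : realType) (n m : nat) (u : nat -> R -> R) (e : R) :
  derivative_chain n.+1 u -> square_integrable (u n.+1) -> 0 < e ->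
  (m <= n)%N -> exists2 A, 0 < A &
    forall x, A <= x -> u (n - m)%N x ^+ 2 <= e * x ^+ (2 * m).+1.
Proof.
move=> [acu du] L2u.
elim: m e => [|m IHm] e e0 mn; apply: increment_aty => //.
  have e40 : 0 < e / 4 by rewrite divr_gt0.
  have [A A0 HA] := integral_small_aty e40 L2u.
  exists A => // x Ax; rewrite subn0 muln0 expr1 mulrC.
  have := ac_holder A0 Ax (acu n (ltnSn n)) (du n (ltnSn n)) L2u.
  move=> /le_trans; apply; apply: ler_pM => //; [lra| |lra|].
    by apply: Rintegral_ge0 => z _; exact: sqr_ge0.
  by apply: HA.
have e40 : 0 < e / 4 by rewrite divr_gt0.
have [A A0 HA] := IHm _ e40 (ltnW mn).
exists A => // x Ax; have x0 : 0 < x by exact: lt_le_trans Ax.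
have nm : (n - m.+1 <= n)%N by exact: leq_subr.
have dv := du (n - m.+1)%N nm; rewrite subnSK// in dv.
pose M := Num.sqrt (e / 4 * x ^+ (2 * m).+1).
have M0 : 0 <= M by exact: sqrtr_ge0.
have M2 : M ^+ 2 = e / 4 * x ^+ (2 * m).+1.
  by rewrite sqr_sqrtr// mulr_ge0 ?exprn_ge0// ltW.
have := ac_lipschitz A0 Ax (acu (n - m.+1)%N nm) dv.
move=> /(_ M)/(_ _) H.
have {}H : `|u (n - m.+1)%N x - u (n - m.+1)%N A| <= M * x.
  apply: (@le_trans _ _ (M * (x - A))); last first.
    by rewrite ler_wpM2l//; lra.
  apply: H => t /andP[At tx].
  rewrite -ler_sqr ?nnegrE// real_normK ?num_real// M2.
  apply: (le_trans (HA t (ltW At))); rewrite ler_wpM2l ?(ltW e40)//.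
  by rewrite lerXn2r ?nnegrE ?ltW// (lt_trans A0).
rewrite -[leLHS]real_normK ?num_real//.
apply: (@le_trans _ _ ((M * x) ^+ 2)).
  by rewrite lerXn2r ?nnegrE// mulr_ge0// ltW.
by rewrite exprMn M2 mulnS add2n !(exprS x) expr0 mulr1; lra.
Qed.

(** * Vanishing at 0 *)

(** On []0, 1]] the function [u n] is Hölder of exponent 1/2, and each lower one has a bounded
    derivative, hence is Lipschitz. The squared form covers both in one induction. *)
Lemma chain_holder_at0 (R : realType) (n m : nat) (u : nat -> R -> R) :
  derivative_chain n.+1 u -> square_integrable (u n.+1) -> (m <= n)%N ->
  exists2 K, 0 <= K & forall x y, 0 < x -> x <= y -> y <= 1 ->
    (u (n - m)%N y - u (n - m)%N x) ^+ 2 <= K * (y - x).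
Proof.
move=> [acu du] L2u; elim: m => [|m IHm] mn.
  exists (\int[@lebesgue_measure R]_(t in @Iopen R) (u n.+1 t ^+ 2)).
    by apply: Rintegral_ge0 => z _; exact: sqr_ge0.
  move=> x y x0 xy y1; rewrite subn0 mulrC.
  have := ac_holder x0 xy (acu n (ltnSn n)) (du n (ltnSn n)) L2u.
  move=> /le_trans; apply; rewrite ler_wpM2l ?subr_ge0//.
  exact: le_Rintegral_Iopen.
have [K K0 HK] := IHm (ltnW mn).
have nm : (n - m.+1 <= n)%N by exact: leq_subr.
have dv := du (n - m.+1)%N nm; rewrite subnSK// in dv.
(* Bounds the derivative by its value at 1 plus an increment; [K <= (K + 1)^2] spares a square
   root. *)
pose M := `|u (n - m)%N 1| + (K + 1).
have M0 : 0 <= M by rewrite addr_ge0// addr_ge0.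
exists (M ^+ 2) => [|x y x0 xy y1]; first exact: sqr_ge0.
have := ac_lipschitz x0 xy (acu (n - m.+1)%N nm) dv.
move=> /(_ M)/(_ _) H.
have {}H : `|u (n - m.+1)%N y - u (n - m.+1)%N x| <= M * (y - x).
  apply: H => t /andP[xt ty]; have t0 : 0 < t by exact: lt_trans xt.
  have t1 : t <= 1 by rewrite (le_trans (ltW ty)).
  have -> : u (n - m)%N t = u (n - m)%N 1 - (u (n - m)%N 1 - u (n - m)%N t).
    by rewrite subKr.
  rewrite (le_trans (ler_normB _ _))// lerD// -ler_sqr ?nnegrE ?addr_ge0//.
  rewrite real_normK ?num_real// (le_trans (HK _ _ t0 t1 (lexx _)))//.
  have : K * (1 - t) <= K * 1 by rewrite ler_wpM2l//; lra.
  have := sqr_ge0 K; rewrite sqrrD; lra.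
rewrite -[leLHS]real_normK ?num_real//.
apply: (@le_trans _ _ ((M * (y - x)) ^+ 2)).
  by rewrite lerXn2r ?nnegrE// mulr_ge0// subr_ge0.
rewrite exprMn ler_wpM2l ?sqr_ge0// expr2 ler_piMl ?subr_ge0//; lra.
Qed.

Lemma chain_lower_bound (R : realType) (n k m : nat) (u : nat -> R -> R)
    (s d c : R) :
  derivative_chain n u -> (k < n)%N ->
  (forall i, (i < k)%N -> vanishes_at0 (u i)) ->
  0 < c -> (forall y, 0 < y < d -> c <= s * u k y) ->
  (m <= k)%N -> exists2 c', 0 < c' &
    forall y, 0 < y < d -> c' * y ^+ m <= s * u (k - m)%N y.
Proof.
move=> [acu du] kn u0 c0 uc; elim: m => [|m IHm] mk.
  by exists c => // y yd; rewrite subn0 expr0 mulr1 uc.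
have [c' c'0 Hc'] := IHm (ltnW mk).
have ik : (k - m.+1 < k)%N by rewrite ltn_subrL (leq_ltn_trans _ mk).
have iN : (k - m.+1 < n)%N by exact: ltn_trans kn.
have dv := du _ iN; rewrite subnSK// in dv.
have slope := fun a b L a0 ab => @ac_slope_ge _ _ _ a b s L a0 ab (acu _ iN) dv.
(* The slope is nonnegative and the limit at 0 is zero. Dividing [e] by [|s| + 1] works for every
   [s]. *)
have pos y : 0 < y < d -> 0 <= s * u (k - m.+1)%N y.
  move=> /andP[y0 yd]; apply/ler_addgt0Pr => e e0.
  have s1 : 0 < `|s| + 1 by rewrite ltr_wpDl.
  have es0 : 0 < e / (`|s| + 1) by rewrite divr_gt0.
  have [r r0 ur] := u0 _ ik _ es0.
  pose a := Num.min (r / 2) (y / 2).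
  have a0 : 0 < a by rewrite lt_min !divr_gt0.
  have ar : a < r by rewrite gt_min; apply/orP; left; lra.
  have ay : a < y by rewrite gt_min; apply/orP; right; lra.
  have := slope a y 0 a0 (ltW ay) _; rewrite mul0r => /(_ _)H.
  have {}H : 0 <= s * u (k - m.+1)%N y - s * u (k - m.+1)%N a.
    apply: H => x /andP[ax xy]; apply: le_trans (Hc' x _).
      by rewrite mulr_ge0 ?exprn_ge0 ?ltW// (lt_trans a0).
    by rewrite (lt_trans a0 ax) (lt_trans xy yd).
  have ua : `|u (k - m.+1)%N a| < e / (`|s| + 1) by apply: ur; rewrite a0.
  have : `|s * u (k - m.+1)%N a| <= e.
    rewrite normrM; apply: (@le_trans _ _ ((`|s| + 1) * (e / (`|s| + 1)))).
      by apply: ler_pM => //; [rewrite lerDl|exact: ltW].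
    by rewrite mulrC divfK// gt_eqF.
  rewrite ler_norml => /andP[? _]; lra.
(* Only the growth over [[y / 2, y]] is counted: there the slope is at least [c' * (y / 2) ^+ m],
   and the length is [y / 2]. *)
exists (c' / 2 ^+ m.+1) => [|y /andP[y0 yd]]; first by rewrite divr_gt0// exprn_gt0.
have y20 : 0 < y / 2 by rewrite divr_gt0.
have y2y : y / 2 <= y by lra.
have H : c' * (y / 2) ^+ m * (y - y / 2) <=
    s * u (k - m.+1)%N y - s * u (k - m.+1)%N (y / 2).
  apply: slope => // x /andP[yx xy]; apply: le_trans (Hc' x _); last first.
    by rewrite (lt_trans y20 yx) (lt_trans xy yd).
  by rewrite ler_wpM2l ?(ltW c'0)// lerXn2r ?nnegrE ?ltW// (lt_trans y20).
have := pos (y / 2); rewrite y20 (le_lt_trans y2y yd) => /(_ isT) pos2.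
have -> : c' / 2 ^+ m.+1 * y ^+ m.+1 = c' * (y / 2) ^+ m * (y - y / 2).
  rewrite !exprS expr_div_n; field.
  by rewrite expf_neq0.
lra.
Qed.

(** If [v^2 >= c / y^2] near 0, the integral over [[a, 2a]] is at least [c / (4a)], which is
    unbounded as [a] tends to 0. *)
Lemma square_integrable_not_pole (R : realType) (v : R -> R) (d c : R) :
  0 < d -> 0 < c -> square_integrable v ->
  ~ (forall y, 0 < y < d -> c <= y ^+ 2 * v y ^+ 2).
Proof.
move=> d0 c0 L2v vc.
set I := \int[@lebesgue_measure R]_(x in @Iopen R) (v x ^+ 2).
have I0 : 0 <= I by apply: Rintegral_ge0 => z _; exact: sqr_ge0.
(* The first bound keeps [[a, 2 * a]] inside []0, d[]; the second makes [c / (4 * a) >= I + 1]. *)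
pose a := Num.min (d / 4) (c / (4 * (I + 1))).
have cI0 : 0 < c / (4 * (I + 1)) by rewrite divr_gt0// mulr_gt0//; lra.
have a0 : 0 < a by rewrite lt_min cI0 andbT; lra.
have ad : a <= d / 4 by rewrite ge_min lexx.
have ac : a * (4 * (I + 1)) <= c.
  by rewrite -ler_pdivlMr ?ge_min ?lexx ?orbT// mulr_gt0//; lra.
have a2a : a < 2 * a by lra.
have int2 := square_integrable_itv (2 * a) a0 L2v.
have int1 : (@lebesgue_measure R).-integrable `[a, 2 * a]
    (EFin \o cst (c / (2 * a) ^+ 2)).
  apply: measurable_bounded_integrable => //.
  - by rewrite /= lebesgue_measure_itv/=; case: ifP => // _; rewrite -EFinD ltry.
  - by exists (`|c / (2 * a) ^+ 2|); split => [|M /ltW lM x _];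
      [exact: num_real|exact: lM].
have : \int[@lebesgue_measure R]_(x in `[a, 2 * a]) (c / (2 * a) ^+ 2) <= I.
  apply: le_trans (le_Rintegral_Iopen (2 * a) a0 L2v).
  apply: le_Rintegral => // x; rewrite /= in_itv/= => /andP[ax xa].
  have x0 : 0 < x by exact: lt_le_trans ax.
  have := vc x; rewrite x0/= => /(_ _) H.
  have {}H : c <= x ^+ 2 * v x ^+ 2 by apply: H; lra.
  rewrite ler_pdivrMr ?exprn_gt0//; last lra.
  rewrite (le_trans H)// mulrC ler_wpM2l ?sqr_ge0// lerXn2r ?nnegrE//; lra.
rewrite Rintegral_cst//.
rewrite [X in _ * X](_ : _ = a); last first.
  have := @lebesgue_measure_itv R `[a, 2 * a].
  rewrite /= lte_fin a2a => /(congr1 fine)/= ->.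
  by lra.
have -> : c / (2 * a) ^+ 2 * a = c / (4 * a).
  by field; rewrite gt_eqF.
rewrite ler_pdivrMr; last by lra.
move=> H; nra.
Qed.

Lemma chain_vanishes (R : realType) (n : nat) (u : nat -> R -> R) :
  derivative_chain n.+1 u -> square_integrable (u n.+1) ->
  square_integrable (fun x => u 0%N x / x ^+ n.+1) ->
  forall k, (k <= n)%N -> vanishes_at0 (u k).
Proof.
move=> cu L2u L2u0 k; have [p] := ubnP k.
elim: p k => // p IHp k kp kn.
have {}IHp i : (i < k)%N -> vanishes_at0 (u i).
  by move=> ik; apply: IHp; [exact: leq_trans ik kp|exact: ltnW (leq_trans ik kn)].
move=> e e0; apply: contrapT => nd.
have [K K0] := chain_holder_at0 cu L2u (leq_subr k n); rewrite subKn// => HK.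
(* As [K * d <= e^2 / 4], [u k] varies from any of its values by at most [e / 2] on []0, d[]. Once
   it reaches size [e] there, it keeps its sign and stays of size at least [e / 2]. *)
pose d := Num.min 1 (e ^+ 2 / (4 * (K + 1))).
have eK0 : 0 < e ^+ 2 / (4 * (K + 1)) by rewrite divr_gt0 ?exprn_gt0// mulr_gt0//; lra.
have d0 : 0 < d by rewrite lt_min eK0 ltr01.
have d1 : d <= 1 by rewrite ge_min lexx.
have dK : d * (4 * (K + 1)) <= e ^+ 2.
  by rewrite -ler_pdivlMr ?ge_min ?lexx ?orbT// mulr_gt0//; lra.
have [x xd ux] : exists2 x, 0 < x < d & e <= `|u k x|.
  apply: contrapT => nx; apply: nd; exists d => // x xd.
  by rewrite ltNge; apply/negP => ex; apply: nx; exists x.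
have close y : 0 < y < d -> `|u k y - u k x| <= e / 2.
  move=> /andP[y0 yd]; have /andP[x0 xd'] := xd.
  rewrite -ler_sqr ?nnegrE//; last by rewrite ltW// divr_gt0.
  rewrite real_normK ?num_real// expr_div_n.
  have [xy|/ltW yx] := leP x y.
    have := HK x y x0 xy _ => /(_ _)H.
    have {}H : (u k y - u k x) ^+ 2 <= K * (y - x) by apply: H; lra.
    have : K * (y - x) <= K * d by rewrite ler_wpM2l//; lra.
    lra.
  have := HK y x y0 yx _ => /(_ _)H.
  have {}H : (u k x - u k y) ^+ 2 <= K * (x - y) by apply: H; lra.
  have : K * (x - y) <= K * d by rewrite ler_wpM2l//; lra.
  rewrite -sqrrN opprB; lra.
pose s : R := Num.sg (u k x).
have s1 : `|s| = 1 by rewrite /s normr_sg; case: eqP ux => //= ->; rewrite normr0; lra.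
have us y : 0 < y < d -> e / 2 <= s * u k y.
  move=> /close uyx.
  have : `|s * (u k y - u k x)| <= e / 2 by rewrite normrM s1 mul1r.
  have sux : s * u k x = `|u k x| by rewrite [RHS]normrEsg.
  rewrite ler_norml mulrBr sux => /andP[+ _]; lra.
have e20 : 0 < e / 2 by rewrite divr_gt0.
have [c c0] := chain_lower_bound cu kn IHp e20 us (leqnn k); rewrite subnn => Hc.
(* Since [y < 1] and [k <= n], [|u 0 y| >= c y^k >= c y^n], so [u 0 / y^(n+1)] has size at least
   [c / y]. *)
apply: (square_integrable_not_pole d0 (exprn_gt0 2 c0) L2u0) => y yd.
have /andP[y0 yd'] := yd.
have uy : c * y ^+ k <= `|u 0%N y|.
  rewrite (le_trans (Hc _ yd))// (le_trans (ler_norm _))// normrM s1 mul1r//.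
have yn : y ^+ n <= y ^+ k by rewrite ler_wiXn2l// ?ltW// (lt_le_trans yd').
have yn0 : 0 < y ^+ n by rewrite exprn_gt0.
have -> : y ^+ 2 * (u 0%N y / y ^+ n.+1) ^+ 2 = (`|u 0%N y| / y ^+ n) ^+ 2.
  rewrite (exprS y n) !expr_div_n real_normK ?num_real//; field.
  by rewrite !gt_eqF.
have H : c <= `|u 0%N y| / y ^+ n.
  by rewrite ler_pdivlMr// (le_trans _ uy)// ler_wpM2l// ltW.
by rewrite lerXn2r ?nnegrE ?(le_trans (ltW c0) H) ?(ltW c0).
Qed.

(** * Complex-valued functions *)

Lemma chain_at0 (R : realType) (n m : nat) (u : nat -> R -> R) (e : R) :
  derivative_chain n.+1 u -> square_integrable (u n.+1) ->
  (forall j, (j <= n)%N -> vanishes_at0 (u j)) -> 0 < e ->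
  (m <= n)%N -> exists2 d, 0 < d &
    forall x, 0 < x < d -> u (n - m)%N x ^+ 2 <= e * x ^+ (2 * m).+1.
Proof.
move=> cu L2u u0 e0 mn; have [d d0 intd] := integral_small_at0 e0 L2u.
exists d => // x /andP[x0 xd]; apply: (chain_bound cu L2u u0 x0) => // a b a0 ab bx.
by apply: intd => //; exact: le_lt_trans xd.
Qed.

Lemma square_integrable_eq (R : realType) (v w : R -> R) :
  (forall x, 0 < x -> v x = w x) ->
  square_integrable v -> square_integrable w.
Proof.
move=> vw [mv iv]; split.
  by apply: eq_measurable_fun mv => x; rewrite inE IopenE => /vw.
apply: le_lt_trans iv; rewrite le_eqVlt; apply/orP; left; apply/eqP.
by apply: eq_integral => x; rewrite inE IopenE => /vw ->.
Qed.

(** The boolean index lets each real result be transferred to both parts by a single statement. *)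
Definition component (R : realType) (b : bool) (z : R[i]) : R :=
  if b then complex.Re z else complex.Im z.

Lemma sqr_cabs (R : realType) (z : R[i]) :
  cabs z ^+ 2 = component true z ^+ 2 + component false z ^+ 2.
Proof. by rewrite sqr_sqrtr// addr_ge0// sqr_ge0. Qed.

Lemma componentB (R : realType) (b : bool) (z w : R[i]) :
  component b (z - w) = component b z - component b w.
Proof. by case: z w b => [? ?] [? ?] []. Qed.

Lemma component_le (R : realType) (b : bool) (z : R[i]) :
  `|component b z| <= cabs z.
Proof.
rewrite -ler_sqr ?nnegrE ?sqrtr_ge0// real_normK ?num_real// sqr_cabs.
by case: b; rewrite ?lerDl ?lerDr sqr_ge0.
Qed.

Lemma component_div (R : realType) (b : bool) (z : R[i]) (r : R) :
  component b (z / r%:C%C) = component b z / r.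
Proof.
rewrite -[_^-1](fmorphV (real_complex R)).
by case: z b => x y []; rewrite /= ?mulr0 ?subr0 ?add0r.
Qed.

Lemma L2_component (R : realType) (g : R -> R[i]) :
  L2 g <-> forall b, square_integrable (fun x => component b (g x)).
Proof.
have cabsE x : ((cabs (g x) ^+ 2)%:E =
    (component true (g x) ^+ 2)%:E + (component false (g x) ^+ 2)%:E)%E.
  by rewrite sqr_cabs.
split=> [[mr [mi ig]] b|sqi].
  have mb : measurable_fun (@Iopen R) (fun x => component b (g x)) by case: b.
  split => //; apply: le_lt_trans ig; apply: ge0_le_integral => //.
  - exact: measurable_Iopen.
  - by move=> x _; rewrite lee_fin sqr_ge0.
  - by apply/measurable_EFinP; exact: measurable_funX.
  - under eq_fun do rewrite cabsE.
    by apply: emeasurable_funD; apply/measurable_EFinP; exact: measurable_funX.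
  - move=> x _; rewrite lee_fin -[leLHS]real_normK ?num_real//.
    by rewrite lerXn2r ?nnegrE ?sqrtr_ge0// component_le.
have [mr ir] := sqi true; have [mi ii] := sqi false.
split => //; split => //.
under eq_integral do rewrite cabsE.
rewrite ge0_integralD//.
- by rewrite lte_add_pinfty.
- exact: measurable_Iopen.
- by move=> x _; rewrite lee_fin sqr_ge0.
- by apply/measurable_EFinP; exact: measurable_funX.
- by move=> x _; rewrite lee_fin sqr_ge0.
- by apply/measurable_EFinP; exact: measurable_funX.
Qed.

Lemma abs_cont_component (R : realType) (b : bool) (x y : R) (g : R -> R[i]) :
  abs_cont_on x y g -> ac_on x y (fun t => component b (g t)).
Proof.
move=> acg e e0; have [d d0 H] := acg e e0; exists d => // k s t st dis sd.
apply: le_lt_trans (H k s t st dis sd); apply: ler_sum => i _.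
by rewrite -componentB component_le.
Qed.

Lemma cderiv_component (R : realType) (b : bool) (g : R -> R[i]) (x : R) l :
  cderiv g x l -> is_derive x 1 (fun t => component b (g t)) (component b l).
Proof. by case: b => -[]. Qed.

Lemma derivs_chain (R : realType) (D : set R) (AC : (R -> R[i]) -> Prop)
    (n : nat) (f : R -> R[i]) (g : nat -> R -> R[i]) (b : bool) :
  @Iopen R `<=` D -> (forall h, AC h -> ACloc_o0 h) -> derivs D AC n f g ->
  derivative_chain n (fun j x => component b (g j x)).
Proof.
move=> ID ACo [_ [acg dg]]; split => j jn.
  move=> x y x0 xy; apply: abs_cont_component; exact: (ACo _ (acg j jn)).
apply: filterS (dg j jn); first exact: (ae_filter_ringOfSetsType (@lebesgue_measure R)).
by move=> x dgx /ID Dx; exact: cderiv_component (dgx Dx).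
Qed.

Lemma ACloc_c0_o0 (R : realType) (h : R -> R[i]) : ACloc_c0 h -> ACloc_o0 h.
Proof.
move=> ach a b a0 ab e e0.
have [d d0 H] := ach b (lt_le_trans a0 ab) e e0.
exists d => // k s t st; apply: H => i; have [? [? ?]] := st i.
by split => //; exact: le_trans (ltW a0) _.
Qed.

Lemma ACloc_c0_vanishes (R : realType) (h : R -> R[i]) (b : bool) :
  ACloc_c0 h -> h 0 = 0 -> vanishes_at0 (fun x => component b (h x)).
Proof.
move=> ach h0 e e0.
have [d d0 hd] := ac_unif (abs_cont_component b (ach 1 ltr01)) e0.
exists (Num.min d 1) => [|x]; first by rewrite lt_min d0/=.
rewrite lt_min => /and3P[x0 xd x1].
have := hd 0 x (lexx _) (ltW x0) (ltW x1); rewrite subr0 => /(_ xd).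
by rewrite h0 [component b 0](_ : _ = 0) ?subr0//; case: b {hd}.
Qed.

(** Brings the exponent of the limits (ii) and (iii), for order [n.+1], to the form [2m + 1] with
    [m = n - j] used along chains. *)
Lemma sub_exponent (n j : nat) : (j <= n)%N ->
  (2 * n.+1 - 2 * j - 1 = (2 * (n - j)).+1)%N.
Proof. by move=> jn; rewrite -mulnBr subSn// mulnS add2n subn1. Qed.

Lemma cabs_ratio_le (R : realType) (z : R[i]) (X e : R) : 0 < X ->
  (forall b, component b z ^+ 2 <= e / 2 * X) ->
  `|0 - cabs z ^+ 2 / X| <= e.
Proof.
move=> X0 H; rewrite sub0r normrN ger0_norm; last first.
  by rewrite divr_ge0 ?sqr_ge0// ltW.
rewrite ler_pdivrMr// sqr_cabs; have := H true; have := H false; lra.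
Qed.

(** * Both claims, by passing to real and imaginary parts *)

Unset Implicit Arguments.

Theorem theorem3p2 (R : realType) :
  (forall (n : nat) (f : R -> R[i]) (g : nat -> R -> R[i]),
     (0 < n)%N -> H_c0 n f g ->
     [/\ (forall j, (j <= n)%N ->
            L2 (fun x => g (n - j)%N x / (x ^+ j)%:C%C)),
         (forall j, (j < n)%N ->
            (fun x => cabs (g j x) ^+ 2 / x ^+ (2 * n - 2 * j - 1))
              x @[x --> +oo] --> 0)
       & (forall j, (j < n)%N ->
            (fun x => cabs (g j x) ^+ 2 / x ^+ (2 * n - 2 * j - 1))
              x @[x --> 0^'+] --> 0)]) /\
  (forall (n : nat) (f : R -> R[i]) (g : nat -> R -> R[i]),
     (0 < n)%N -> Hhat n f g ->
     Hhat n.-1 (g 1%N) (fun j => g j.+1)).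
Proof.
split=> [[//|n] f g _ [dg [L2g g0]]|[//|n] f g _ [dg [L2g L2f]]].
  have cu b : derivative_chain n.+1 (fun j x => component b (g j x)).
    apply: derivs_chain dg; last exact: ACloc_c0_o0.
    by move=> x; rewrite IopenE /Iclosed/= in_itv/= andbT => /ltW.
  have L2u b := (L2_component (g n.+1)).1 L2g b.
  have u0 b j : (j <= n)%N -> vanishes_at0 (fun x => component b (g j x)).
    by move=> jn; apply: ACloc_c0_vanishes; [exact: dg.2.1|exact: g0].
  split => [j jn|j jn|j jn].
  - apply/L2_component => b; have := chain_hardy (cu b) (L2u b) (u0 b) jn.
    by apply: square_integrable_eq => x x0; rewrite component_div.
  - apply/cvgrPdist_le => e e0; rewrite sub_exponent//.
    have e20 : 0 < e / 2 by rewrite divr_gt0.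
    have [A A0 HA] := chain_aty (cu true) (L2u true) e20 (leq_subr j n).
    have [B B0 HB] := chain_aty (cu false) (L2u false) e20 (leq_subr j n).
    near=> x.
    have Ax : A <= x by near: x; apply: nbhs_pinfty_ge; rewrite num_real.
    have Bx : B <= x by near: x; apply: nbhs_pinfty_ge; rewrite num_real.
    apply: cabs_ratio_le; first by rewrite exprn_gt0// (lt_le_trans A0).
    by case; [have := HA x Ax|have := HB x Bx]; rewrite subKn.
  - apply/cvgrPdist_le => e e0; rewrite sub_exponent//.
    have e20 : 0 < e / 2 by rewrite divr_gt0.
    have [A A0 HA] := chain_at0 (cu true) (L2u true) (u0 true) e20 (leq_subr j n).
    have [B B0 HB] := chain_at0 (cu false) (L2u false) (u0 false) e20 (leq_subr j n).
    near=> x.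
    have x0 : 0 < x by near: x; exact: nbhs_right_gt.
    have Ax : x < A by near: x; exact: nbhs_right_lt.
    have Bx : x < B by near: x; exact: nbhs_right_lt.
    apply: cabs_ratio_le; first by rewrite exprn_gt0.
    by case; [have := HA x|have := HB x]; rewrite subKn// x0 ?Ax ?Bx; apply.
have cu b : derivative_chain n.+1 (fun j x => component b (g j x)).
  exact: derivs_chain dg.
have L2u b := (L2_component (g n.+1)).1 L2g b.
have [fg [acg dgg]] := dg.
split; first by split => //; split => j jn; [exact: acg|exact: dgg].
split => //; apply/L2_component => b.
(* Here vanishing at 0 is not given; it is drawn from the integrability of [f / x^(n+1)]. *)
have u0 : forall j, (j <= n)%N -> vanishes_at0 (fun x => component b (g j x)).
  apply: (chain_vanishes (cu b) (L2u b)).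
  have := (L2_component _).1 L2f b; apply: square_integrable_eq => x x0.
  by rewrite component_div fg// IopenE.
(* Stopping the induction at [k = n] leaves the first derivative over [x^n], the weighted condition
   for [f']. *)
have := chain_hardy (cu b) (L2u b) u0 (leqnSn n); rewrite subSnn.
by apply: square_integrable_eq => x x0; rewrite component_div.
Unshelve. all: by end_near. Qed.
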